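(* (In ZFC.) There exists a functionally Hausdorff countably compact paratopological group which is not a topological group and whose underlying abstract group is free Abelian.
   Context: A paratopological group is a group endowed with a topology for which multiplication is (jointly) continuous; it is a topological group if inversion is also continuous. A space $X$ is functionally Hausdorff if for any distinct $x,y\in X$ there is a continuous $f:X\to\mathbb R$ with $f(x)\neq f(y)$. A space is countably compact if every countable open cover has a finite subcover. *)

(* Defs.v *)
From HB Require Import structures.
From mathcomp Require Import all_boot all_algebra.
From mathcomp Require Import all_classical all_reals all_analysis.
From mathcomp Require Import freeg.

Set Implicit Arguments.
Unset Strict Implicit.
Unset Printing Implicit Defensive.

Import numFieldTopology.Exports.

Local Open Scope classical_set_scope.

#[short(type="preTopologicalGroupType")]
HB.structure Definition PreTopologicalGroup := {G of Topological G & Group G}.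

HB.mixin Record PreTopologicalGroup_isParatopologicalGroup G
    & PreTopologicalGroup G := {
  mulg_continuous : continuous (fun x : G * G => (x.1 * x.2)%g) ;
}.

#[short(type="paratopologicalGroupType")]
HB.structure Definition ParatopologicalGroup :=
  {G of PreTopologicalGroup G & PreTopologicalGroup_isParatopologicalGroup G}.

Definition is_topological_group (G : paratopologicalGroupType) : Prop :=
  continuous (fun x : G => x^-1%g).

Definition functionally_hausdorff (R : realType) (X : topologicalType) : Prop :=
  forall x y : X, x <> y -> exists2 f : X -> R, continuous f & f x <> f y.

Definition countably_compact (X : topologicalType) : Prop :=
  forall C : set (set X), countable C ->
    (forall U, C U -> open U) -> \bigcup_(U in C) U = [set: X] ->
  exists D : set (set X),
    [/\ finite_set D, D `<=` C & \bigcup_(U in D) U = [set: X]].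

(* [{freeg K}] is the additive group of finitely supported formal sums of
   elements of [K] with integer coefficients, hence the change from additive to
   multiplicative notation along the isomorphism [f]. *)
Definition is_free_abelian (G : groupType) : Prop :=
  exists (K : choiceType) (f : {freeg K} -> G),
    bijective f /\ forall x y, f (x + y)%R = (f x * f y)%g.

(* Main.v *)
Require Import Defs.
From mathcomp Require Import all_boot all_algebra.
From mathcomp Require Import all_classical all_reals all_analysis.
From HB Require Import structures.
From mathcomp Require Import all_order.
From mathcomp Require Import freeg lra zify.

(** The group is the free abelian group G on a type [gen] of generators in which every
    family of elements of G indexed by nat * nat has a formal limit: [term_surjective]
    provides, for each such family, a generator x with [term x] equal to it, and the
    generators occurring in [term x] lie strictly below x in a well-founded order.

    Attach to each generator x an ultrafilter [ultra x] on nat * nat, and call admissible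
    the homomorphisms from G to the circle R/Z whose value at x is the limit of their
    values at [term x n] along [ultra x], for all good x. For the topology induced by the
    admissible homomorphisms, x is a cluster point of [term x]. Here x is good if its
    family is sparse (the l1 norms grow very fast) or scattered (the norms are bounded and
    the supports are pairwise disjoint). Up to a translation and a sign, every sequence in
    G that takes each value finitely often has such a subsequence:
    [unbounded_subsequence] and [bounded_subsequence]. So every sequence has a cluster
    point.

    This topology is refined by the cone of the elements whose leading terms have positive
    coefficients: the neighbourhoods of 0 are the traces on the cone of the previous ones.
    The cone is a semigroup, so addition stays continuous. Cluster points survive, because
    the difference of x and [term x n] has leading term x and thus lies in the cone:
    [accumulation]. But the cone meets its opposite only at 0, so continuity of the
    inversion would make 0 isolated, against the existence of cluster points.

    What remains is the heart of the proof: the admissible homomorphisms separate the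
    points, [admissible_separation]. Let v be a nonzero element. Only the countable set D of
    the generators in the support of v and below it matters; elsewhere a homomorphism is
    extended by recursion, taking limits along the ultrafilters. On D one needs a
    homomorphism phi which does not vanish at v, with phi(term x n - x) tending to 0 along
    a set of [ultra x], for each good x in D. The ultrafilters are chosen beforehand so as
    to make this possible for every D. The indices (N, i) with i < [blen N] form the block
    N. To each x corresponds an infinite set of blocks, its [trace], and distinct
    generators have almost disjoint traces; hence for a countable D one may assume, after
    omitting finitely many blocks for each x, that each block serves one generator. The
    ultrafilter of x contains all sets which miss a small part only of the blocks in the
    trace of x, and the blocks grow so fast that giving up the indices that conflict with
    any of the earlier blocks is small in this sense: [large_kept].

    The remaining elements [term x n - x] form, when sorted by [rank], an approximately
    triangular system for the values of phi, which [solve_triangular] solves modulo 1. A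
    scattered member has generators of its own by which its value can be corrected without
    touching the previous ones. A sparse member of norm b is corrected by changing phi by
    at most 1/b at each generator, which changes the value at an element of norm a by at
    most a/b, and these errors have a small sum. *)

Set Implicit Arguments.
Unset Strict Implicit.
Unset Printing Implicit Defensive.

Import Order.TTheory GRing.Theory Num.Theory.
Import numFieldNormedType.Exports.

Local Open Scope classical_set_scope.
Local Open Scope ring_scope.

(** * Distance to the nearest integer *)

Section DistInt.
Variable R : realType.
Implicit Types x y : R.

(** Homomorphisms to the circle R/Z are represented by real functionals, and [dist_int] is
    the invariant metric of R/Z read on representatives. *)
Definition dist_int x : R := `|x - (Num.floor (x + 2^-1))%:~R|.

Lemma dist_int_ge0 x : 0 <= dist_int x.
Proof. exact: normr_ge0. Qed.

Lemma dist_int_le12 x : dist_int x <= 2^-1.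
Proof.
have /andP[h1 h2] := floor_itv (x + 2^-1).
rewrite /dist_int ler_norml; move: h1 h2; rewrite intrD.
set m := (Num.floor _)%:~R; lra.
Qed.

Lemma dist_int_le x (m : int) : dist_int x <= `|x - m%:~R|.
Proof.
have [->|mf] := eqVneq m (Num.floor (x + 2^-1)); first by [].
apply: (le_trans (dist_int_le12 x)).
have /andP[h1 h2] := floor_itv (x + 2^-1).
move: h1 h2; rewrite intrD /=.
have [mlt|mgt|] := ltgtP m (Num.floor (x + 2^-1)); last by move/eqP; rewrite (negbTE mf).
- have : (m + 1)%:~R <= (Num.floor (x + 2^-1))%:~R :> R by rewrite ler_int lezD1.
  rewrite intrD; set f := (Num.floor _)%:~R => ? ? ?.
  by rewrite ger0_norm; lra.
- have : (Num.floor (x + 2^-1) + 1)%:~R <= m%:~R :> R by rewrite ler_int lezD1.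
  rewrite intrD; set f := (Num.floor _)%:~R => ? ? ?.
  by rewrite ler0_norm; lra.
Qed.

Lemma dist_int_le_norm x : dist_int x <= `|x|.
Proof. by have := dist_int_le x 0; rewrite subr0. Qed.

Lemma dist_int_int (m : int) : dist_int m%:~R = 0.
Proof.
apply/eqP; rewrite eq_le dist_int_ge0 andbT.
by have := dist_int_le m%:~R m; rewrite subrr normr0.
Qed.

Lemma dist_intD x y : dist_int (x + y) <= dist_int x + dist_int y.
Proof.
apply: (le_trans (dist_int_le _ (Num.floor (x + 2^-1) + Num.floor (y + 2^-1)))).
by rewrite intrD opprD addrACA ler_normD.
Qed.

Lemma dist_intN x : dist_int (- x) = dist_int x.
Proof.
wlog suff: x / dist_int (- x) <= dist_int x.
  by move=> h; apply/eqP; rewrite eq_le h /= -{1}[x]opprK h.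
apply: (le_trans (dist_int_le _ (- Num.floor (x + 2^-1)))).
by rewrite mulrNz opprK -normrN opprD !opprK.
Qed.

Lemma dist_intB x y : dist_int (x - y) <= dist_int x + dist_int y.
Proof. by rewrite -[dist_int y]dist_intN dist_intD. Qed.

Lemma dist_int_dist x y : `|dist_int x - dist_int y| <= dist_int (x - y).
Proof.
rewrite ler_norml; apply/andP; split.
  by have := dist_intB x (x - y); rewrite opprB addrC subrK; lra.
by have := dist_intD (x - y) y; rewrite subrK; lra.
Qed.

Lemma dist_int12 : dist_int (2^-1) = 2^-1.
Proof.
rewrite /dist_int (_ : 2^-1 + 2^-1 = 1%:~R :> R); last by lra.
by rewrite floorK ?intr_int // ler0_norm; lra.
Qed.

(** Compactness of the circle: the fractional parts lie in [0, 1], where every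
    ultrafilter converges. *)
Lemma ultra_lim (I : Type) (p : set_system I) (x : I -> R) :
  UltraFilter p -> exists l, forall e, 0 < e -> p [set i | dist_int (x i - l) < e].
Proof.
move=> pU.
pose y i := x i - (Num.floor (x i))%:~R.
have cpt : compact (`[0, 1]%classic : set R) := @segment_compact R 0 1.
have /cpt [l [_ cl]] : (y @ p) (`[0, 1]%classic : set R).
  have yU i : (`[0, 1]%classic : set R) (y i).
    rewrite /= in_itv /= /y.
    have /andP[] := floor_itv (x i); rewrite intrD.
    by move=> ? ?; apply/andP; split; lra.
  exact: (@filterS I p _ setT _ (fun i _ => yU i) filterT).
exists l => e e0.
have [//|] := in_ultra_setVsetC [set i | dist_int (x i - l) < e] pU.
move=> pC; exfalso.
set C := ~` _ in pC.
have yC : (y @ p) (y @` C).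
  by apply: (@filterS I p _ C _ _ pC) => i Ci; exists i.
have [z [[i Ci <-]]] := cl _ _ yC (nbhsx_ballx l e e0).
rewrite /ball /= => yl; apply: Ci.
apply: le_lt_trans yl; rewrite distrC.
by apply: le_trans (dist_int_le _ (Num.floor (x i))) _; rewrite /y addrAC.
Qed.

End DistInt.

(** * Free abelian groups: the l1 norm and real functionals *)

Section FreeAbelian.
Variable K : choiceType.
Implicit Types (u v : {freeg K}) (k : K).

Definition l1 v : nat := \sum_(k <- dom v) `|coeff k v|%N.

Lemma sum_dom_widen (V : nmodType) (f : K -> V) v (E : seq K) : uniq E ->
  {subset dom v <= E} -> (forall k, k \notin dom v -> f k = 0) ->
  \sum_(k <- dom v) f k = \sum_(k <- E) f k.
Proof.
move=> uE sE f0; rewrite [RHS](bigID [in dom v]) /=.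
rewrite [X in _ + X]big1 ?addr0; last by move=> k /f0.
rewrite -[RHS]big_filter; apply: perm_big.
apply: uniq_perm; [exact: uniq_dom|exact: filter_uniq|].
by move=> k; rewrite mem_filter; case: (boolP (k \in dom v)) => // /sE ->.
Qed.

Lemma l1_widen v (E : seq K) : uniq E -> {subset dom v <= E} ->
  l1 v = (\sum_(k <- E) `|coeff k v|)%N.
Proof.
by move=> uE sE; apply: (@sum_dom_widen nat) => // k kv; rewrite coeff_outdom.
Qed.

Lemma size_dom_l1 v : (size (dom v) <= l1 v)%N.
Proof.
rewrite -sum1_size /l1 !big_seq; apply: leq_sum => k.
by rewrite mem_dom absz_gt0.
Qed.

Lemma coeff_le_l1 v k : (`|coeff k v| <= l1 v)%N.
Proof.
have [kv|kv] := boolP (k \in dom v); last by rewrite coeff_outdom.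
by rewrite /l1 (bigD1_seq k) ?uniq_dom //= leq_addr.
Qed.

Lemma l1_eq0 v : (l1 v == 0)%N = (v == 0).
Proof.
rewrite -dom_eq0; apply/idP/idP => [h|/eqP h]; last by rewrite /l1 h big_nil.
by rewrite -size_eq0 -leqn0 (leq_trans (size_dom_l1 v)) // leqn0.
Qed.

Lemma l1N v : l1 (- v) = l1 v.
Proof.
rewrite (@l1_widen (- v) (dom v)) ?uniq_dom //; last by move=> k; rewrite domN.
by apply: eq_bigr => k _; rewrite coeffN abszN.
Qed.

Lemma coeffU1 k k' : coeff k' (<< k >> : {freeg K}) = (k == k')%:R.
Proof. by rewrite coeffU mul1r. Qed.

Lemma l1_subU v k : k \notin dom v -> l1 (v - << k >>) = (l1 v).+1.
Proof.
move=> kv; rewrite (@l1_widen _ (k :: dom v)) /= ?kv ?uniq_dom //; last first.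
  move=> j; rewrite mem_dom coeffB coeffU1 inE [k == j]eq_sym.
  by have [//|_] := eqVneq j k; rewrite mulr0n subr0 -mem_dom.
rewrite big_cons coeffB coeffU1 eqxx (coeff_outdom kv) add0r abszN1 add1n.
congr _.+1; rewrite /l1 !big_seq; apply: eq_bigr => j jv.
rewrite coeffB coeffU1; have [e|_] := eqVneq k j; last by rewrite mulr0n subr0.
by rewrite e jv in kv.
Qed.

Lemma dom_subU v k j : j \in dom (v - << k >>) -> j \in dom v \/ j = k.
Proof.
rewrite !mem_dom coeffB coeffU1; have [->|_] := eqVneq k j; first by right.
by rewrite mulr0n subr0; left.
Qed.

(** Drives the induction on the norm in [bounded_subsequence]. *)
Lemma l1_remove v k : k \in dom v -> (l1 (v - << coeff k v *g k >>)%R < l1 v)%N.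
Proof.
move=> kv; rewrite (@l1_widen _ (dom v)) ?uniq_dom //; last first.
  move=> j; rewrite !mem_dom coeffB coeffU; have [<-|_] := eqVneq k j.
    by rewrite mulr1 subrr eqxx.
  by rewrite mulr0 subr0.
rewrite /l1 !(bigD1_seq k) ?uniq_dom //=.
rewrite coeffB coeffU eqxx mulr1 subrr absz0 add0n.
rewrite (eq_bigr (fun j => `|coeff j v|%N)); last first.
  move=> j jk; rewrite coeffB coeffU eq_sym (negbTE jk) mulr0 subr0 //.
by rewrite -[X in (X < _)%N]add0n ltn_add2r absz_gt0 -mem_dom.
Qed.

Section Evaluation.
Variable R : realType.
Implicit Types phi psi : K -> R.

(** The homomorphism to R that extends the values [phi] given on the generators. *)
Definition ev phi v : R := \sum_(k <- dom v) (coeff k v)%:~R * phi k.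

Lemma ev_widen phi v (E : seq K) : uniq E -> {subset dom v <= E} ->
  ev phi v = \sum_(k <- E) (coeff k v)%:~R * phi k.
Proof.
by move=> uE sE; apply: (@sum_dom_widen R) => // k kv; rewrite coeff_outdom // mul0r.
Qed.

Lemma evD phi u v : ev phi (u + v) = ev phi u + ev phi v.
Proof.
pose E := undup (dom u ++ dom v).
rewrite !(@ev_widen _ _ E) ?undup_uniq //.
- by rewrite -big_split; apply: eq_bigr => k _; rewrite coeffD intrD mulrDl.
- by move=> k kv; rewrite mem_undup mem_cat kv orbT.
- by move=> k kv; rewrite mem_undup mem_cat kv.
- by move=> k /domD_subset; rewrite mem_undup.
Qed.

Lemma ev0 phi : ev phi 0 = 0.
Proof. by rewrite /ev dom0 big_nil. Qed.

Lemma evN phi v : ev phi (- v) = - ev phi v.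
Proof. by apply/eqP; rewrite -addr_eq0 -evD addNr ev0. Qed.

Lemma evB phi u v : ev phi (u - v) = ev phi u - ev phi v.
Proof. by rewrite evD evN. Qed.

Lemma evU phi (c : int) k : ev phi << c *g k >> = c%:~R * phi k.
Proof.
have [->|c0] := eqVneq c 0; first by rewrite freegU0 ev0 mul0r.
by rewrite /ev domU // big_seq1 coeffU eqxx mulr1.
Qed.

Lemma ev_sum phi (I : Type) (s : seq I) (F : I -> {freeg K}) :
  ev phi (\sum_(i <- s) F i) = \sum_(i <- s) ev phi (F i).
Proof. by elim: s => [|i s IH]; rewrite ?big_nil ?ev0 // !big_cons evD IH. Qed.

Lemma ev_addmul phi psi (c : R) v :
  ev (fun k => phi k + c * psi k) v = ev phi v + c * ev psi v.
Proof.
rewrite /ev mulr_sumr -big_split; apply: eq_bigr => k _; rewrite mulrDr.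
by rewrite mulrCA.
Qed.

Lemma eq_ev phi psi v : {in dom v, phi =1 psi} -> ev phi v = ev psi v.
Proof.
by move=> e; rewrite /ev !big_seq; apply: eq_bigr => k kv; rewrite e.
Qed.

Lemma ev_bound phi v (e : R) : (forall k, k \in dom v -> `|phi k| <= e) ->
  `|ev phi v| <= (l1 v)%:R * e.
Proof.
move=> h; apply: le_trans (ler_norm_sum _ _ _) _.
rewrite /l1 natr_sum mulr_suml !big_seq; apply: ler_sum => k kv.
rewrite normrM; apply: ler_pM => //; last exact: h.
by rewrite natr_absz intr_norm.
Qed.

(** The perturbation used to correct the value at [v]: among the functionals with value 1
    at [v] it has the least sup norm, so it disturbs another element [w] by at most
    [l1 w / l1 v], and not at all when the supports are disjoint. *)
Definition dual v : K -> R := fun k => (Num.sg (coeff k v))%:~R / (l1 v)%:R.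

Lemma dual_le v k : `|dual v k| <= ((l1 v)%:R)^-1.
Proof.
rewrite /dual normrM normfV [`|_%:R|]ger0_norm // -[leRHS]mul1r.
apply: ler_wpM2r; first by rewrite invr_ge0.
by rewrite -intr_norm normr_sg; case: eqP.
Qed.

Lemma dual_eq0 v k : k \notin dom v -> dual v k = 0.
Proof. by move=> kv; rewrite /dual coeff_outdom // sgr0 mul0r. Qed.

Lemma ev_dual v : v != 0 -> ev (dual v) v = 1.
Proof.
move=> v0; rewrite /ev /dual.
under eq_bigr do rewrite mulrA -intrM [_ * Num.sg _]mulrC -normrEsg.
rewrite -mulr_suml; under eq_bigr do rewrite -natr_absz.
by rewrite -natr_sum -/(l1 v) divff // pnatr_eq0 l1_eq0.
Qed.

Lemma ev_dual_le u v : `|ev (dual u) v| <= (l1 v)%:R / (l1 u)%:R.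
Proof. by apply: ev_bound => k _; exact: dual_le. Qed.

Lemma ev_dual_disjoint u v : (forall k, k \in dom v -> k \notin dom u) ->
  ev (dual u) v = 0.
Proof.
move=> h; rewrite /ev big_seq big1 // => k /h ku.
by rewrite dual_eq0 // mulr0.
Qed.

End Evaluation.
End FreeAbelian.

(** * A type of generators closed under limits of sequences *)

(** A generator [limpt d g] is a formal limit of the family whose member of index n is the
    integer combination of the generators [g i] with the coefficients listed in [d n].
    Indexing by nat * nat prepares the division into blocks: the index (N, i) is the i-th
    index of block N. *)
Inductive gen : Type :=
| origin
| limpt (d : nat * nat -> seq (int * nat)) (g : nat -> gen).

HB.instance Definition _ := gen_eqMixin gen.
HB.instance Definition _ := gen_choiceMixin gen.

(** The strict subterm relation. It is the well-founded order along which functionals are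
    extended, and its maximal elements play the role of leading terms in [cone]. *)
Fixpoint below (x : gen) : set gen :=
  if x is limpt _ g then [set y | exists i, y = g i \/ below (g i) y] else set0.

Lemma below_trans x y z : below x y -> below y z -> below x z.
Proof.
elim: x => [//|d g IH] /= [i [->|yi]] yz; exists i; right => //.
exact: (IH i yi yz).
Qed.

Lemma below_irr x : ~ below x x.
Proof.
elim: x => [//|d g IH] [i /=[e|/= b]].
  by apply: (IH i); rewrite -{1}e; exists i; left.
by apply: (IH i); apply: below_trans b _ => /=; exists i; left.
Qed.

Lemma countable_below x : countable (below x).
Proof.
elim: x => [|d g IH] /=; first exact: countable0.
rewrite (_ : [set _ | _] = \bigcup_i \bigcup_(b in [set: bool])
    if b then [set g i] else below (g i)).
  apply: bigcup_countable => // i _; apply: bigcup_countable => // -[] _; last exact: IH.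
  by apply: finite_set_countable; exact: finite_set1.
apply/seteqP; split => [y [i [->|yi]]|y [i _ [[] _ yi]]]; exists i => //.
- by exists true.
- by exists false.
- by left.
- by right.
Qed.

Definition term (x : gen) (n : nat * nat) : {freeg gen} :=
  if x is limpt d g then \sum_(ci <- d n) << ci.1 *g g ci.2 >> else 0.

Lemma dom_term x n k : k \in dom (term x n) -> below x k.
Proof.
case: x => [|d g] /=; first by rewrite dom0.
move=> /dom_sum_subset /flattenP [s /mapP[/= ci _ ->]].
have [->|c0] := eqVneq ci.1 0; first by rewrite freegU0 dom0.
by rewrite domU // inE => /eqP ->; exists ci.2; left.
Qed.

Lemma term_notin x n : x \notin dom (term x n).
Proof. by apply/negP => /dom_term /below_irr. Qed.

(** A generator is a countably branching well-founded tree with countable data, so it is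
    determined by a real number: the data read along each finite path. *)
Fixpoint code (x : gen) (s : seq nat) : nat :=
  match x, s with
  | limpt d _, [::] => 1
  | limpt d _, [:: 0, N, i & _] => pickle (d (N, i))
  | limpt _ g, i.+1 :: t => code (g i) t
  | _, _ => 0
  end%N.

Lemma code_inj x y : code x =1 code y -> x = y.
Proof.
elim: x y => [|d g IH] [|d' g'] //= e; try by move: (e [::]).
have -> : d = d'.
  apply/funext => -[N i]; apply: (pcan_inj pickleK).
  exact: (e [:: 0; N; i]%N).
have -> // : g = g'.
by apply/funext => i; apply: IH => s; exact: (e (i.+1 :: s)).
Qed.

(** * Almost disjoint traces, blocks and ultrafilters *)

Definition prefix_code (x : gen) (n : nat) : nat :=
  pickle (mkseq (fun i => code x (odflt [::] (unpickle i))) n).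

Lemma prefix_code_inj x y n m : prefix_code x n = prefix_code y m ->
  n = m /\ forall i, (i < n)%N ->
    code x (odflt [::] (unpickle i)) = code y (odflt [::] (unpickle i)).
Proof.
move=> /(pcan_inj pickleK) e.
have nm : n = m by have := congr1 size e; rewrite !size_mkseq.
split => // i ilt; have := congr1 (fun s => nth 0 s i)%N e.
by rewrite !nth_mkseq // -nm.
Qed.

Definition trace (x : gen) : set nat := range (prefix_code x).

Lemma trace_unbounded x m : exists2 N, trace x N & (m <= N)%N.
Proof.
apply: contrapT => h.
pose f (i : 'I_m.+1) : 'I_m.+1 := inord (prefix_code x i).
have lt (i : nat) : (prefix_code x i < m)%N.
  rewrite ltnNge; apply/negP => mi; apply: h.
  by exists (prefix_code x i) => //; exists i.
have finj : injective f.
  move=> i j /(congr1 val); rewrite /= !inordK ?ltnS 1?ltnW //.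
  by move=> /prefix_code_inj[/val_inj].
have [g _ fg] := injF_bij finj.
have /(congr1 val) := fg ord_max; rewrite /= inordK => [e|]; last exact/ltnW/lt.
by have := lt (g ord_max); rewrite e ltnn.
Qed.

(** Two distinct reals have only finitely many common prefixes, and a prefix determines its
    length. *)
Lemma trace_ad x y : x <> y ->
  exists m, forall N, trace x N -> trace y N -> (N < m)%N.
Proof.
move=> xy.
have [i xyi] : exists i, code x (odflt [::] (unpickle i)) <>
                         code y (odflt [::] (unpickle i)).
  apply: contrapT => h; apply: xy; apply: code_inj => s.
  apply: contrapT => ne; apply: h; exists (pickle s).
  by rewrite pickleK.
(* Common prefixes stop before the first difference, at position i. *)
exists (\sum_(n < i.+1) (prefix_code x n).+1)%N => N [n _ <-] [m _ /esym].
move=> /prefix_code_inj[_ h].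
have ni : (n < i.+1)%N.
  by rewrite ltnS leqNgt; apply/negP => /h.
by rewrite (bigD1 (Ordinal ni)) //= leq_addr.
Qed.

(** The total length of the blocks before block N. The summand is [blen M] unfolded, since
    the length of a block depends on the total length of the previous ones. *)
Fixpoint elapsed (N : nat) : nat :=
  if N is M.+1 then (elapsed M + (M * (M.+1 * (elapsed M).+1)).+1)%N else 0%N.

(** Enough for the indices that block N has to give up, see [large_kept]: each of the
    [elapsed N] earlier members spoils at most N + 1 of them, and at most N are spoiled by
    the norm of the member or by [v]. *)
Definition slack N := (N.+1 * (elapsed N).+1)%N.

(** Longer than N times the slack, so that no fixed number of sets which each miss at most
    [slack N] indices can exhaust block N for all N. *)
Definition blen N := (N * slack N).+1.

Definition missed (U : set (nat * nat)) (N : nat) : nat :=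
  count (fun i => `[< ~ U (N, i) >]) (iota 0 (blen N)).

Lemma missed_sub (U V : set (nat * nat)) N : U `<=` V -> (missed V N <= missed U N)%N.
Proof.
by move=> UV; apply: sub_count => i /asboolP nV; apply/asboolP => /UV.
Qed.

Lemma missedI (U V : set (nat * nat)) N :
  (missed (U `&` V) N <= missed U N + missed V N)%N.
Proof.
rewrite /missed -count_predUI; apply: leq_trans (leq_addr _ _).
apply: sub_count => i /asboolP h /=; rewrite -asbool_or; apply/asboolP.
by apply: contrapT => /not_orP[/contrapT ? /contrapT ?]; apply: h.
Qed.

(** The factor k makes the intersection of two large sets large. *)
Definition large (x : gen) : set_system (nat * nat) :=
  [set U | exists k m, forall N, trace x N -> (m <= N)%N ->
     (missed U N <= k * slack N)%N].

(** Proper because [blen N] exceeds [k * slack N] once N >= k, and the trace is infinite. *)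
Lemma large_filter x : ProperFilter (large x).
Proof.
split=> [[k [m h]]|].
  have [N xN] := trace_unbounded x (maxn k m); rewrite geq_max => /andP[kN mN].
  have := h N xN mN; rewrite /missed (@eq_count _ _ xpredT); last first.
    by move=> i; apply/asboolP.
  rewrite count_predT size_iota leqNgt ltnS leq_mul2r.
  by rewrite kN orbT.
split.
- exists 0%N, 0%N => N _ _; rewrite /missed (@eq_count _ _ pred0) ?count_pred0 //.
  by move=> i; apply/negbTE/asboolPn => h; apply: h.
- move=> U V [k [m h]] [k' [m' h']]; exists (k + k')%N, (maxn m m') => N xN.
  rewrite geq_max => /andP[mN mN']; rewrite mulnDl.
  by apply: leq_trans (missedI _ _ _) (leq_add (h N xN mN) (h' N xN mN')).
- move=> U V UV [k [m h]]; exists k, m => N xN mN.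
  exact: leq_trans (missed_sub N UV) (h N xN mN).
Qed.

Lemma large_cofinite x (U : set (nat * nat)) m :
  (forall N i, (m <= N)%N -> U (N, i)) -> large x U.
Proof.
move=> h; exists 0%N, m => N _ mN; rewrite /missed (@eq_count _ _ pred0) ?count_pred0 //.
by move=> i; apply/negbTE/asboolPn => nU; apply: nU; exact: h.
Qed.

Definition ultra (x : gen) : set_system (nat * nat) :=
  projT1 (cid (ultraFilterLemma (large_filter x))).

Lemma ultraP x : UltraFilter (ultra x).
Proof. by rewrite /ultra; case: cid => ? []. Qed.

Lemma large_ultra x U : large x U -> ultra x U.
Proof. by rewrite /ultra; case: cid => ? [_] /=; apply. Qed.

(** * Approximately triangular systems modulo 1 *)

Lemma min_seq (I : eqType) (n : I -> nat) (s : seq I) : s != [::] ->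
  exists2 i, i \in s & forall j, j \in s -> (n i <= n j)%N.
Proof.
elim: s => [//|i [|i' s] IH] _.
  by exists i; rewrite ?inE // => j; rewrite inE => /eqP ->.
have [//|j js jmin] := IH.
have [ij|ji] := leqP (n i) (n j).
  exists i; first by rewrite inE eqxx.
  move=> k; rewrite inE => /predU1P[->//|/jmin]; exact: leq_trans.
exists j; first by rewrite inE js orbT.
by move=> k; rewrite inE => /predU1P[->|/jmin //]; exact: ltnW.
Qed.

(** Used to count the indices lost in a block: each of them is charged to an obstacle, and
    no obstacle is charged twice. *)
Lemma count_witness (T : eqType) (P : pred nat) (L : nat) (Z : seq T)
    (r : T -> nat -> Prop) :
  (forall i, (i < L)%N -> P i -> exists2 z, z \in Z & r z i) ->
  (forall z i j, r z i -> r z j -> i = j) ->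
  (count P (iota 0 L) <= size Z)%N.
Proof.
move=> hP hr.
have [f fP] : {f : nat -> option T & forall i, (i < L)%N -> P i ->
    exists2 z, z \in Z & r z i /\ f i = Some z}.
  suff /choice[f fP] : forall i, exists o : option T, (i < L)%N -> P i ->
      exists2 z, z \in Z & r z i /\ o = Some z by exists f.
  move=> i; have [iL|_] := boolP (i < L)%N; last by exists None.
  have [Pi|_] := boolP (P i); last by exists None.
  by have [z zZ rz] := hP i iL Pi; exists (Some z) => _ _; exists z.
rewrite -size_filter -(size_map f) -(size_map Some Z); apply: uniq_leq_size.
  rewrite map_inj_in_uniq ?filter_uniq ?iota_uniq // => i j.
  rewrite !mem_filter !mem_iota !add0n /= => /andP[Pi iL] /andP[Pj jL].
  have [z _ [rz ->]] := fP i iL Pi; have [z' _ [rz' ->]] := fP j jL Pj.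
  by move=> [e]; apply: (hr z) => //; rewrite e.
move=> o /mapP[i]; rewrite mem_filter mem_iota add0n /= => /andP[Pi iL] ->.
by have [z zZ [_ ->]] := fP i iL Pi; apply: map_f.
Qed.

Lemma filter_all_seq (T : Type) (I : eqType) (F : set_system T) (s : seq I)
    (A : I -> set T) : Filter F -> (forall i, i \in s -> F (A i)) ->
  F [set t | forall i, i \in s -> A i t].
Proof.
move=> FF; elim: s => [|i s IH] h; first by apply: filterE => t i; rewrite in_nil.
have h1 : F (A i) by apply: h; rewrite inE eqxx.
have h2 : F [set t | forall j, j \in s -> A j t].
  by apply: IH => j js; apply: h; rewrite inE js orbT.
apply: filterS (filterI h1 h2) => t [At Ast] j.
by rewrite inE => /predU1P[->//|/Ast].
Qed.

Section Approximation.
Variable R : realType.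

(** The largest term is at most 1/m, and each of the others has at least twice its
    denominator: the sum is dominated by a geometric series. *)
Lemma sum_inv_sparse (I : eqType) (n : I -> nat) (s : seq I) (m : nat) :
  uniq s -> (0 < m)%N -> (forall i, i \in s -> (m <= n i)%N) ->
  (forall i j, i \in s -> j \in s -> i != j ->
    (2 * n i <= n j)%N \/ (2 * n j <= n i)%N) ->
  \sum_(i <- s) (n i)%:R^-1 <= 2 / m%:R :> R.
Proof.
elim: {s}(size s) {-2}s (erefl (size s)) m => [|l IH] s sz m us m0 hm h.
  by rewrite (size0nil sz) big_nil divr_ge0.
have [|i si imin] := min_seq n (s := s); first by rewrite -size_eq0 sz.
have ni0 : (0 < n i)%N by apply: leq_trans (hm i si).
rewrite (perm_big _ (perm_to_rem si)) big_cons /=.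
have le : \sum_(j <- rem i s) (n j)%:R^-1 <= 2 / (2 * n i)%:R :> R.
  apply: IH => //.
  - by rewrite size_rem // sz.
  - exact: rem_uniq.
  - by rewrite muln_gt0.
  - move=> j; rewrite mem_rem_uniq // inE => /andP[/= ji js].
    by have := imin j js; case: (h j i js si ji); lia.
  - move=> j k; rewrite !mem_rem_uniq // !inE => /andP[/= _ js] /andP[/= _ ks].
    exact: h.
apply: (@le_trans _ _ (2 / (n i)%:R)).
  have e : 2 / (2 * n i)%:R = (n i)%:R^-1 :> R.
    by rewrite natrM invfM mulrA divff ?mul1r // pnatr_eq0.
  by rewrite e in le; rewrite mulr_natl mulr2n lerD2l.
apply: ler_wpM2l => //; rewrite lef_pV2 ?posrE ?ltr0n //.
by rewrite ler_nat hm.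
Qed.

Variable K : choiceType.
Implicit Types (phi psi : K -> R) (w : {freeg K}).

(** The equations are solved modulo 1 one after the other, by increasing rank. The equation
    i is solved exactly by adding a multiple, of absolute value at most 1, of [psi i]; the
    only errors left at [z i] come from the corrections made afterwards. *)
Lemma solve_triangular (I : eqType) (z : I -> {freeg K}) (psi : I -> K -> R)
    (rank : I -> nat) (s : seq I) phi0 :
  uniq s -> (forall i, i \in s -> ev (psi i) (z i) = 1) ->
  exists phi,
    (forall i, i \in s -> dist_int (ev phi (z i)) <=
       \sum_(j <- s | (j != i) && (rank i <= rank j)%N) `|ev (psi j) (z i)|) /\
    forall w, `|ev phi w - ev phi0 w| <= \sum_(j <- s) `|ev (psi j) w|.
Proof.
move=> us h1.
pose ge i j := (rank j <= rank i)%N.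
have ge_tr : transitive ge by move=> y x t xy yt; exact: leq_trans yt xy.
have ge_tot : total ge by move=> x y; exact: leq_total.
have ps : perm_eq (sort ge s) s by rewrite perm_sort.
suff [phi [hphi hw]] : exists phi,
    (forall i, i \in sort ge s -> dist_int (ev phi (z i)) <=
       \sum_(j <- sort ge s | (j != i) && (rank i <= rank j)%N) `|ev (psi j) (z i)|) /\
    forall w, `|ev phi w - ev phi0 w| <= \sum_(j <- sort ge s) `|ev (psi j) w|.
  exists phi; split=> [i si|w]; last by rewrite -(perm_big _ ps) hw.
  by rewrite -(perm_big _ ps) hphi // mem_sort.
have : sorted ge (sort ge s) by exact: sort_sorted.
have : uniq (sort ge s) by rewrite sort_uniq.
have {h1} : forall i, i \in sort ge s -> ev (psi i) (z i) = 1.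
  by move=> i; rewrite mem_sort; exact: h1.
elim: (sort ge s) => [|i0 t IH] h1 /=.
  by exists phi0; split=> [//|w]; rewrite subrr normr0 big_nil.
move=> /andP[i0t ut] pt.
have ot : all (ge i0) t by exact: order_path_min.
have [|||phi [hphi hw]] := IH => //.
- by move=> i it; apply: h1; rewrite inE it orbT.
- exact: path_sorted pt.
set a := ev phi (z i0).
pose c : R := (Num.floor (a + 2^-1))%:~R - a.
have c1 : `|c| <= 1.
  by rewrite /c distrC; apply: le_trans (dist_int_le12 a) _; lra.
have cle w i : `|c * ev (psi i) w| <= `|ev (psi i) w|.
  by rewrite normrM ler_piMl.
exists (fun k => phi k + c * psi i0 k); split=> [i|w].
- rewrite ev_addmul inE => /predU1P[->|it].
    rewrite h1 ?inE ?eqxx // mulr1 /c -/a addrC subrK dist_int_int.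
    exact: sumr_ge0.
  have ii0 : i0 != i by apply: contraNneq i0t => ->.
  rewrite big_cons ii0 (allP ot i it : (rank i <= rank i0)%N) /=.
  apply: le_trans (dist_intD _ _) _; rewrite addrC; apply: lerD (hphi i it).
  exact: le_trans (dist_int_le_norm _) (cle _ _).
- rewrite ev_addmul big_cons addrAC addrC.
  apply: le_trans (ler_normD _ _) _; apply: lerD; first exact: cle.
  exact: hw.
Qed.

Lemma dist_intM (c : int) (x : R) : dist_int (c%:~R * x) <= `|c|%N%:R * dist_int x.
Proof.
apply: le_trans (dist_int_le _ (c * Num.floor (x + 2^-1))) _.
by rewrite intrM -mulrBr normrM natr_absz intr_norm.
Qed.

Lemma dist_int_ev phi psi w : dist_int (ev phi w - ev psi w) <=
  \sum_(k <- dom w) `|coeff k w|%N%:R * dist_int (phi k - psi k).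
Proof.
rewrite /ev -sumrB.
elim: (dom w) => [|k s IH]; first by rewrite !big_nil (dist_int_int R 0).
rewrite !big_cons; apply: le_trans (dist_intD _ _) _; apply: lerD => //.
by rewrite -mulrBr; exact: dist_intM.
Qed.

(** Compactness of the group of homomorphisms to the circle. *)
Lemma ev_ultra_lim (I : Type) (q : set_system I) (f : I -> K -> R) :
  UltraFilter q -> exists phi, forall w e, 0 < e ->
    q [set i | dist_int (ev (f i) w - ev phi w) < e].
Proof.
move=> qU.
have /choice[phi phiP] : forall k, exists l, forall e, 0 < e ->
    q [set i | dist_int (f i k - l) < e] by move=> k; exact: ultra_lim.
exists phi => w e e0.
pose d := e / (l1 w).+1%:R.
have d0 : 0 < d by rewrite divr_gt0.
have qd : q [set i | forall k, k \in dom w -> dist_int (f i k - phi k) < d].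
  apply: (filter_all_seq (A := fun k => [set i | dist_int (f i k - phi k) < d])).
  by move=> k _; exact: phiP.
apply: filterS qd => i /= hi; apply: le_lt_trans (dist_int_ev _ _ _) _.
apply: (@le_lt_trans _ _ ((l1 w)%:R * d)).
  rewrite /l1 natr_sum mulr_suml !big_seq; apply: ler_sum => k kw.
  by apply: ler_wpM2l => //; exact: ltW (hi k kw).
by rewrite /d mulrCA gtr_pMr // ltr_pdivrMr // mul1r ltr_nat.
Qed.

End Approximation.

(** * Sparse and scattered families, and the blocks that serve them *)

(** The exponent 4 leaves room: one given number can be within a square of at most one of
    the norms, see [large_kept]. *)
Definition sparse (x : gen) : Prop :=
  (forall n, (1 < l1 (term x n))%N) /\
  forall n n', n <> n' -> (l1 (term x n) ^ 4 <= l1 (term x n'))%N \/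
                          (l1 (term x n') ^ 4 <= l1 (term x n))%N.

Definition scattered (x : gen) : Prop :=
  [/\ forall n, term x n != 0,
      forall n n' k, n <> n' -> k \in dom (term x n) -> k \notin dom (term x n')
    & exists C, forall n, (l1 (term x n) <= C)%N].

Definition good x := sparse x \/ scattered x.

(** The functional to be built must not vanish at [v] and must respect the families of the
    generators in [D]. From [start x] on the traces of the elements x of [D] are disjoint,
    so that each block serves at most one generator, and the blocks are long enough compared
    with [v] and with the norms in a scattered family of x. *)
Section Blocks.
Variables (R : realType) (v : {freeg gen}) (D : set gen) (start : gen -> nat).
Hypothesis start_uniq : forall x y N, D x -> D y -> trace x N -> trace y N ->
  (start x <= N)%N -> (start y <= N)%N -> x = y.
Hypothesis start_v : forall x, D x -> (8 * l1 v + 2 <= start x)%N.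
Hypothesis start_bound : forall x n, D x -> scattered x -> (l1 (term x n) <= start x)%N.

Definition owns N x := [/\ D x, good x, trace x N & (start x <= N)%N].

Lemma owns_uniq N x y : owns N x -> owns N y -> x = y.
Proof. by move=> [Dx _ xN sx] [Dy _ yN sy]; exact: (start_uniq Dx Dy xN yN). Qed.

(** The generator served by block N; the default value [origin] is used for the blocks that
    serve none. *)
Definition owner N : gen := xget origin (owns N).

Lemma ownerE N x : owns N x -> owner N = x.
Proof.
by move=> h; rewrite /owner; case: xgetP => [y _ yN|/(_ x)//]; exact: owns_uniq yN h.
Qed.

Definition active N : Prop := owns N (owner N).

Definition member (e : nat * nat) : {freeg gen} := term (owner e.1) e.

(** The elements at which the functional must be almost integral, so that the value at the
    generator [owner e.1] is the limit of the values at the members of its family. *)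
Definition relator (e : nat * nat) : {freeg gen} := member e - << owner e.1 >>.

Lemma l1_relator e : l1 (relator e) = (l1 (member e)).+1.
Proof. exact/l1_subU/term_notin. Qed.

Definition of_sparse (e : nat * nat) : bool := `[< sparse (owner e.1) >].

Definition conflict (a b : nat) : Prop := (a < b ^ 2)%N /\ (b < a ^ 2)%N.

Definition earlier (N : nat) (e : nat * nat) : Prop :=
  [/\ active e.1, (e.1 < N)%N & (e.2 < blen e.1)%N].

(** Indices that survive in their block. All obstacles come from earlier blocks, whether
    or not their indices have been kept, so that no recursion is needed. *)
Definition kept (e : nat * nat) : Prop :=
  [/\ active e.1, (e.2 < blen e.1)%N &
    if of_sparse e then (e.1 <= l1 (member e))%N /\
       forall e', earlier e.1 e' -> of_sparse e' ->
         ~ conflict (l1 (member e')) (l1 (member e))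
    else forall k, k \in dom (member e) -> k \notin dom v /\
       forall e', earlier e.1 e' -> (l1 (relator e') <= e.1.+1)%N ->
         k \notin dom (relator e')].

Lemma active_start N : active N -> (8 * l1 v + 2 <= N)%N.
Proof. by move=> [Dx _ _]; apply: leq_trans; exact: start_v. Qed.

Lemma active_bound e : active e.1 -> ~~ of_sparse e -> (l1 (member e) <= e.1)%N.
Proof.
move=> [Dx [sx|sx] _ st] /asboolPn nS; first by case: nS.
by apply: leq_trans st; exact: start_bound.
Qed.

Lemma active_scattered e : active e.1 -> ~~ of_sparse e -> scattered (owner e.1).
Proof. by move=> [_ [sx|//] _ _] /asboolPn []. Qed.

Lemma member_neq0 e : kept e -> member e != 0.
Proof.
move=> [al _ _]; have [/asboolP[h _]|nS] := boolP (of_sparse e).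
  by rewrite -l1_eq0 -lt0n; exact: ltnW (h e).
by have [h _ _] := active_scattered al nS; exact: h.
Qed.

Lemma ev_dual_relator e : kept e -> ev (dual R (member e)) (relator e) = 1.
Proof.
move=> oke; rewrite evB ev_dual ?member_neq0 // evU dual_eq0 ?term_notin //.
by rewrite mulr0 subr0.
Qed.

(** Within one block this is the sparseness of the family of the owner; between two blocks
    it is the absence of conflicts required from the later one. *)
Lemma kept_sparse e e' : kept e -> kept e' -> of_sparse e -> of_sparse e' -> e != e' ->
  (l1 (member e) ^ 2 <= l1 (member e'))%N \/ (l1 (member e') ^ 2 <= l1 (member e))%N.
Proof.
wlog le : e e' / (e.1 <= e'.1)%N.
  move=> h oke oke' Se Se' ee'; have [le|/ltnW le] := leqP e.1 e'.1.
    exact: h.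
  by case: (h e' e le oke' oke Se' Se _); rewrite 1?eq_sym //; [right|left].
move=> [al lt +] [al' lt'] + Se Se' ee'; rewrite Se Se' => _ [_ nc].
have [lt1|eq1] := boolP (e.1 < e'.1)%N.
  have {}nc := nc e (And3 al lt1 lt) Se.
  have [|h1] := leqP (l1 (member e) ^ 2) (l1 (member e')); first by left.
  have [|h2] := leqP (l1 (member e') ^ 2) (l1 (member e)); first by right.
  by case: nc; split.
have e1 : e.1 = e'.1 by apply/eqP; rewrite eqn_leq le leqNgt.
have /asboolP[g1 h] := Se.
have := h e e' (elimN eqP ee'); rewrite {2 3}e1 -/(member e') /member e1.
have pw n : (n ^ 2 <= n ^ 4)%N by case: n => // n; rewrite leq_pexp2l.
by case=> [/(leq_trans (pw _))|/(leq_trans (pw _))]; [left|right].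
Qed.

Lemma kept_fresh e e' k : kept e -> ~~ of_sparse e -> earlier e.1 e' ->
  (l1 (relator e') <= e.1.+1)%N ->
  k \in dom (member e) -> k \notin dom (relator e').
Proof.
by move=> [_ _ oke] /negbTE nS ea le kF; move: oke; rewrite nS => /(_ k kF)[_]; apply.
Qed.

Lemma kept_fresh_block e e' k : kept e -> kept e' -> ~~ of_sparse e -> e.1 = e'.1 ->
  e != e' ->
  k \in dom (member e) -> k \notin dom (relator e').
Proof.
move=> oke oke' nS e1 /eqP ee' kF; have [al _ _] := oke.
have [_ h _] := active_scattered al nS.
apply/negP => /dom_subU[kF'|kx].
  by have := h e e' k ee' kF; rewrite /member -e1 in kF' *; rewrite kF'.
by move: kF; rewrite kx -e1 (negbTE (term_notin _ _)).
Qed.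

(** Scattered members do not disturb [w] at all, and the disturbances by the sparse ones
    are dominated by a geometric series. *)
Lemma tail_bound (s : seq (nat * nat)) (w : {freeg gen}) m : uniq s -> (0 < m)%N ->
  (forall e, e \in s -> kept e) ->
  (forall e, e \in s -> ~~ of_sparse e ->
     forall k, k \in dom (member e) -> k \notin dom w) ->
  (forall e, e \in s -> of_sparse e -> (m <= l1 (member e))%N) ->
  \sum_(e <- s) `|ev (dual R (member e)) w| <= (l1 w)%:R * (2 / m%:R).
Proof.
move=> us m0 oks h0 hm.
have big0 : \sum_(e <- s | ~~ of_sparse e) `|ev (dual R (member e)) w| = 0.
  rewrite big_seq_cond big1 // => e /andP[es nS].
  rewrite ev_dual_disjoint ?normr0 // => k kw.
  by apply/negP => kF; have := h0 e es nS k kF; rewrite kw.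
rewrite (bigID of_sparse) /= big0 addr0.
rewrite -big_filter; set s' := [seq e <- s | of_sparse e].
have inS e : e \in s' -> e \in s /\ of_sparse e by rewrite mem_filter => /andP[].
apply: (@le_trans _ _ (\sum_(e <- s') (l1 w)%:R * (l1 (member e))%:R^-1)).
  by apply: ler_sum => e _; exact: ev_dual_le.
rewrite -mulr_sumr; apply: ler_wpM2l => //; apply: sum_inv_sparse => //.
- exact: filter_uniq.
- by move=> e /inS[es Se]; exact: hm.
- move=> e e' /inS[es Se] /inS[es' Se'] ee'.
  have g1 a : a \in s -> of_sparse a -> (2 <= l1 (member a))%N.
    by move=> sa /asboolP[+ _]; apply.
  have := kept_sparse (oks e es) (oks e' es') Se Se' ee'.
  have := g1 e es Se; have := g1 e' es' Se'; rewrite !expnS !expn0 !muln1.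
  move=> a b [h|h]; [left|right]; apply: leq_trans h; rewrite leq_mul2r; lia.
Qed.

(** The order of correction. A sparse member is corrected at the stage given by its norm
    and a scattered one at the stage given by its block. Even and odd values avoid ties,
    except between scattered members of one block, which do not disturb each other. *)
Definition rank e : nat :=
  if of_sparse e then (2 * (l1 (member e)).+1)%N else (2 * e.1).+1.

Definition block_list n : seq (nat * nat) :=
  [seq (N, i) | N <- iota 0 n, i <- iota 0 (blen N)].

Lemma mem_block_list n e : (e \in block_list n) = (e.1 < n)%N && (e.2 < blen e.1)%N.
Proof.
case: e => N i; apply/allpairsPdep/andP => [[M [j []]]|[Nn iN]].
  by rewrite !mem_iota !add0n => /andP[_ Mn] /andP[_ jM] [-> ->].
by exists N, i; split => //; rewrite mem_iota.
Qed.

Lemma uniq_block_list n : uniq (block_list n).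
Proof.
apply: allpairs_uniq_dep; first exact: iota_uniq.
  by move=> N _; exact: iota_uniq.
by move=> [N i] [M j] _ _ /= [-> ->].
Qed.

Lemma size_block_list n : size (block_list n) = elapsed n.
Proof.
rewrite size_allpairs_dep; elim: n => [//|n IH].
by rewrite -addn1 iotaD map_cat sumn_cat IH /= add0n size_iota addn0 addn1.
Qed.

(** Tends to 0 along the blocks of any given owner, as the norms in a scattered family are
    bounded. *)
Definition tolerance e : R :=
  (if of_sparse e then 4%:R / e.1%:R else (l1 (relator e))%:R * (2 / e.1%:R)).

(** Later corrections hardly disturb [relator e]. A scattered member corrected later lives
    on generators which do not occur in [relator e]. The norm of a sparse member corrected
    later is at least N if [e] is scattered in block N, and at least the square of the norm
    of [member e] if [e] is sparse. *)
Lemma tolerance_bound e (s : seq (nat * nat)) : kept e -> uniq s ->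
  (forall e', e' \in s -> [/\ kept e', e' != e & (rank e <= rank e')%N]) ->
  \sum_(e' <- s) `|ev (dual R (member e')) (relator e)| <= tolerance e.
Proof.
move=> oke us hs; have [al lt hk] := oke.
have e0 : (0 < e.1)%N by apply: leq_trans (active_start al); rewrite addn2.
rewrite /tolerance; case: ifP hk => Se hk; last first.
  apply: tail_bound => // [e' /hs[]//|e' /hs[oke' ee' +] nS k|e' /hs[oke' ee' +] Se'].
    rewrite /rank Se (negbTE nS) ltnS leq_mul2l /= leq_eqVlt => /predU1P[e1|lt1].
      by apply: kept_fresh_block => //; rewrite e1.
    apply: kept_fresh => //; rewrite l1_relator !ltnS.
    exact: leq_trans (active_bound al (negbT Se)) (ltnW lt1).
  by rewrite /rank Se Se'; lia.
case: hk => eF _.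
have F0 : (0 < l1 (member e))%N by exact: leq_trans eF.
have F1 : (1 < l1 (member e))%N by have /asboolP[h _] := Se; exact: h.
apply: (le_trans (tail_bound (m := (l1 (member e) ^ 2)%N) us _ _ _ _)).
- by rewrite expn_gt0 F0.
- by move=> e' /hs[].
- move=> e' /hs[oke' ee' +] nS k; rewrite /rank Se (negbTE nS) => r.
  apply: kept_fresh => //; last by rewrite l1_relator; lia.
  by split=> //; apply: leq_ltn_trans eF _; lia.
- move=> e' /hs[oke' ee' +] Se'; rewrite /rank Se Se' leq_mul2l /= ltnS => le.
  case: (kept_sparse oke oke' Se Se' _) => [|//|h]; first by rewrite eq_sym.
  exfalso; move: F1 le h; rewrite -mulnn; nia.
- rewrite l1_relator; set n := l1 (member e) in F0 F1 eF *.
  have nR : 0 < n%:R :> R by rewrite ltr0n.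
  have n1 : 1 <= n%:R :> R by rewrite ler1n.
  have NR : 0 < e.1%:R :> R by rewrite ltr0n.
  have Nn : e.1%:R <= n%:R :> R by rewrite ler_nat.
  rewrite natrX -natr1 mulrA ler_pdivrMr ?exprn_gt0 // mulrAC ler_pdivlMr //.
  nra.
Qed.

Lemma size_flatten_le (T : eqType) (s : seq (seq T)) m :
  (forall t, t \in s -> (size t <= m)%N) -> (size (flatten s) <= size s * m)%N.
Proof.
elim: s => [//|t s IH] h; rewrite /= size_cat mulSn leq_add ?h ?inE ?eqxx //.
by apply: IH => u us; rewrite h // inE us orbT.
Qed.

(** A sparse index is lost because its norm is smaller than N, which happens at most once
    for each smaller value, or because of a conflict, which each earlier index causes at
    most once. A scattered index is lost because its support meets that of [v] or that of an
    earlier relator of norm at most N + 1; as the supports are disjoint, each of these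
    generators spoils at most one index. *)
Lemma large_kept x : D x -> good x -> large x kept.
Proof.
move=> Dx gx; exists 1%N, (start x) => N xN st; rewrite mul1n.
have lx : owns N x by [].
have cx := ownerE lx; have aN : active N by rewrite /active cx.
have [Se|nS] := pselect (sparse x).
  (* An obstacle is either a value below N or an earlier index. *)
  pose r (z : nat + nat * nat) i := match z with
    | inl a => l1 (member (N, i)) = a
    | inr e => conflict (l1 (member e)) (l1 (member (N, i))) end.
  have F4 i j : i <> j -> (l1 (member (N, i)) ^ 4 <= l1 (member (N, j)))%N \/
                          (l1 (member (N, j)) ^ 4 <= l1 (member (N, i)))%N.
    move=> ij; have [_ h] := Se; rewrite /member cx; apply: h => -[].
    exact: ij.
  have F1 i : (1 < l1 (member (N, i)))%N by have [h _] := Se; rewrite /member cx.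
  apply: (@leq_trans (size ([seq inl a | a <- iota 0 N] ++
      [seq inr e | e <- block_list N] : seq (nat + nat * nat)))); last first.
    rewrite size_cat !size_map size_iota size_block_list /slack; nia.
  apply: (count_witness (r := r)) => [i il /asboolP nok|z i j].
    have [lt|le] := ltnP (l1 (member (N, i))) N.
      exists (inl (l1 (member (N, i)))) => //.
      by rewrite mem_cat map_f ?mem_iota.
    apply: contrapT => nz; apply: nok; split => //.
    have -> : of_sparse (N, i) by apply/asboolP; rewrite /= cx.
    split=> // e' [ae eN el] Se' cf; apply: nz; exists (inr e') => //.
    by rewrite mem_cat [X in _ || X]map_f ?orbT // mem_block_list eN el.
  case: z => [a|e] /=.
    move=> ei ej; apply: contrapT => ij; have := F4 i j ij.
    rewrite ei ej; have := F1 i; rewrite ei => a1.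
    have : (a ^ 1 < a ^ 4)%N by rewrite ltn_exp2l.
    by rewrite expn1 => ? []; lia.
  move=> [c1 c2] [c3 c4]; apply: contrapT => ij.
  move: c1 c2 c3 c4 (F1 i) (F1 j) (F4 i j ij).
  have p4 b : (b ^ 4 = (b * b) * (b * b))%N by rewrite !expnS expn0 muln1 !mulnA.
  rewrite !p4 -!mulnn.
  set a := l1 (member e); set b := l1 (member (N, i)); set c := l1 (member (N, j)).
  move=> c1 c2 c3 c4 b1 c1' [h|h].
    by have := leq_trans (leq_mul (ltnW c1) (ltnW c1)) h; rewrite leqNgt c4.
  by have := leq_trans (leq_mul (ltnW c3) (ltnW c3)) h; rewrite leqNgt c2.
have sx : scattered x by case: gx.
have [_ dx _] := sx.
pose low_dom e := if (l1 (relator e) <= N.+1)%N then dom (relator e) else [::].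
pose bad := dom v ++ flatten [seq low_dom e | e <- block_list N].
apply: (@leq_trans (size bad)); last first.
  rewrite size_cat; apply: (@leq_trans (N + elapsed N * N.+1)).
    apply: leq_add.
      by have := size_dom_l1 v; have := active_start aN; lia.
    rewrite -size_block_list -(size_map low_dom).
    apply: size_flatten_le => t /mapP[e _ ->]; rewrite /low_dom; case: ifP => // le.
    exact: leq_trans (size_dom_l1 _) le.
  by rewrite /slack; lia.
apply: (count_witness (r := fun k i => k \in dom (member (N, i))))
  => [i il /asboolP nok|k i j ki kj].
  apply: contrapT => nz; apply: nok; split => //.
  have -> : of_sparse (N, i) = false by apply/asboolPn; rewrite /= cx.
  move=> k kF; have kb : k \notin bad by apply/negP => kb; apply: nz; exists k.
  move: kb; rewrite mem_cat negb_or => /andP[kv kfl]; split=> // e' [ae eN el] le.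
  apply: contra kfl => kZ; apply/flattenP; exists (dom (relator e')) => //.
  by apply/mapP; exists e'; rewrite ?mem_block_list ?eN ?el // /low_dom le.
apply: contrapT => ij; move: ki kj; rewrite /member cx => ki kj.
have ne : (N, i) <> (N, j) by move=> -[].
by have := dx _ _ k ne ki; rewrite kj.
Qed.

Lemma large_owner x : D x -> good x -> large x [set e | owner e.1 = x].
Proof.
move=> Dx gx; exists 0%N, (start x) => N xN st.
rewrite /missed (@eq_count _ _ pred0) ?count_pred0 // => i.
by apply/negbTE/asboolPn => h; apply: h; exact: ownerE.
Qed.

Definition kept_list n : seq (nat * nat) := [seq e <- block_list n | `[< kept e >]].

(** The initial functional takes the value 1/2 at [v], and the corrections displace it by at
    most 1/4 since no block starts before [8 * l1 v + 2]. *)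
Lemma finite_approximation n : v != 0 -> exists phi : gen -> R,
  (forall e, e \in kept_list n -> dist_int (ev phi (relator e)) <= tolerance e) /\
  4^-1 <= dist_int (ev phi v).
Proof.
move=> v0.
have it e : e \in kept_list n -> kept e by rewrite mem_filter => /andP[/asboolP].
have ui : uniq (kept_list n) by apply: filter_uniq; exact: uniq_block_list.
have [|phi [h1 h2]] := @solve_triangular R gen _ relator
  (fun e => dual R (member e)) rank (kept_list n) (fun k => 2^-1 * dual R v k) ui.
  by move=> e /it; exact: ev_dual_relator.
exists phi; split=> [e ei|].
  apply: le_trans (h1 e ei) _; rewrite -big_filter; apply: tolerance_bound.
  - exact: it.
  - exact: filter_uniq.
  - by move=> e'; rewrite mem_filter => /andP[/andP[ee' r] /it].
have : `|ev phi v - 2^-1| <= (l1 v)%:R * (2 / (8 * l1 v + 2)%:R).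
  have -> : 2^-1 = ev (fun k => 2^-1 * dual R v k) v.
    rewrite /ev; under eq_bigr do rewrite mulrCA.
    by rewrite -mulr_sumr -/(ev _ _) ev_dual // mulr1.
  apply: le_trans (h2 v) _; apply: tail_bound => //.
  - by rewrite addn2.
  - move=> e /it[_ _ +] /negbTE nS k kF; rewrite nS => /(_ k kF)[kv _] //.
  - move=> e /it[al _ +] Se; rewrite Se => -[le _].
    exact: leq_trans (active_start al) le.
have : (l1 v)%:R * (2 / (8 * l1 v + 2)%:R) <= 4^-1 :> R.
  rewrite mulrA ler_pdivrMr ?ltr0n; last by rewrite addn2.
  rewrite natrD natrM.
  have : 0 <= (l1 v)%:R :> R by [].
  lra.
move=> le1 le2.
have := dist_intB (ev phi v) (ev phi v - 2^-1).
rewrite opprB addrC subrK dist_int12 => le3.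
have := dist_int_le_norm (ev phi v - 2^-1).
lra.
Qed.

Lemma countable_approximation : v != 0 -> exists phi : gen -> R,
  4^-1 <= dist_int (ev phi v) /\
  forall x, D x -> good x -> forall e, 0 < e ->
    large x [set n | dist_int (ev phi (term x n) - phi x) < e].
Proof.
move=> v0.
have /choice[f fP] : forall n, exists phi : gen -> R,
    (forall e, e \in kept_list n -> dist_int (ev phi (relator e)) <= tolerance e) /\
    4^-1 <= dist_int (ev phi v) by move=> n; exact: finite_approximation.
(* Pass from the finitely many equations of the blocks before n to all of them. *)
have [q [qU qoo]] := ultraFilterLemma eventually_filter.
have [phi phiP] := ev_ultra_lim f qU.
have near w e m : 0 < e -> exists2 n, (m <= n)%N & dist_int (ev (f n) w - ev phi w) < e.
  move=> e0.
  have qm : q [set n | (m <= n)%N] by apply: qoo; exists m.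
  by have [n [/= mn he]] := filter_ex (filterI qm (phiP w e e0)); exists n.
have limZ e : kept e -> dist_int (ev phi (relator e)) <= tolerance e.
  move=> oke; apply/ler_addgt0Pr => d d0.
  have [n en he] := near (relator e) d e.1.+1 d0.
  have [h _] := fP n.
  have /h {}h : e \in kept_list n.
    have [_ lt _] := oke; rewrite mem_filter mem_block_list en lt /= andbT.
    exact/asboolP.
  have := dist_intB (ev (f n) (relator e)) (ev (f n) (relator e) - ev phi (relator e)).
  by rewrite opprB addrC subrK; lra.
exists phi; split.
  apply/ler_addgt0Pr => d d0.
  have [n _ he] := near v d 0%N d0.
  have [_ h] := fP n.
  have := dist_intD (ev (f n) v - ev phi v) (ev phi v).
  by rewrite subrK; lra.
move=> x Dx gx e e0.
(* The tolerance in block N is at most C / N, for sparse and for scattered x. *)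
pose C := (4 + 2 * (start x).+1)%N.
have [m mC] : exists m, C%:R / e < m%:R.
  by exists (Num.bound (C%:R / e)); apply: archi_boundP; rewrite divr_ge0 // ltW.
have lm : large x [set n | (m < n.1)%N] by apply: (@large_cofinite x _ m.+1).
have lF : ProperFilter (large x) := large_filter x.
apply: filterS (filterI (filterI (large_kept Dx gx) (large_owner Dx gx)) lm).
move=> n [[okn /= cx] mn].
have -> : ev phi (term x n) - phi x = ev phi (relator n).
  by rewrite /relator /member cx evB evU mul1r.
apply: le_lt_trans (limZ n okn) _.
have n0 : 0 < n.1%:R :> R by rewrite ltr0n; exact: leq_ltn_trans mn.
have Cn : C%:R / n.1%:R < e.
  rewrite ltr_pdivrMr // mulrC -ltr_pdivrMr //; apply: lt_trans mC _.
  by rewrite ltr_nat.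
apply: le_lt_trans Cn; rewrite /tolerance; case: ifPn => nS.
  by rewrite ler_pM2r ?invr_gt0 // ler_nat /C leq_addr.
rewrite mulrA ler_pM2r ?invr_gt0 // -natrM ler_nat l1_relator.
have [al _ _] := okn.
have : (l1 (member n) <= start x)%N.
  by rewrite /member cx; apply: start_bound => //; rewrite -cx; exact: active_scattered.
by rewrite /C; lia.
Qed.

End Blocks.

(** * Admissible functionals separate points *)

(** Enumerate [D]: each of its elements has to avoid only the finitely many earlier ones. *)
Lemma trace_separation (D : set gen) : countable D -> exists st : gen -> nat,
  forall x y N, D x -> D y -> trace x N -> trace y N ->
    (st x <= N)%N -> (st y <= N)%N -> x = y.
Proof.
move=> /countable_injP[c cinj].
have sep x b : exists m, forall y, D y -> (c y < b)%N -> x <> y ->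
    forall N, trace x N -> trace y N -> (N < m)%N.
  elim: b => [|b [m hm]]; first by exists 0%N.
  have [[y [Dy cy xy]]|no] := pselect (exists y, [/\ D y, c y = b & x <> y]).
    have [m' hm'] := trace_ad xy; exists (maxn m m') => z Dz.
    rewrite ltnS leq_eqVlt => /predU1P[cz|cz] xz N xN zN; last first.
      by rewrite leq_max (hm z).
    have e : z = y by apply: cinj; rewrite ?inE // cz cy.
    by rewrite leq_max (hm' N) ?orbT // -e.
  exists m => z Dz; rewrite ltnS leq_eqVlt => /predU1P[cz|cz] xz; last exact: hm.
  by case: no; exists z.
have /choice[st stP] : forall x, exists m, forall y, D y -> (c y < c x)%N -> x <> y ->
    forall N, trace x N -> trace y N -> (N < m)%N by move=> x; exact: sep.
exists st => x y N Dx Dy xN yN sx sy; apply: contrapT => xy.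
have [lt|lt|e] := ltngtP (c x) (c y).
- by have := stP y x Dx lt (nesym xy) N yN xN; rewrite ltnNge sy.
- by have := stP x y Dy lt xy N xN yN; rewrite ltnNge sx.
- by apply: xy; apply: cinj; rewrite ?inE.
Qed.

Section Extension.
Variables (R : realType) (D : set gen) (phi : gen -> R).
Variable L : gen -> (nat * nat -> R) -> R.

(** Values prescribed on [D] are extended to all generators by recursion along [below],
    the value at a formal limit being the limit of the values along its family. *)
Fixpoint extend (x : gen) : R :=
  if `[< D x >] then phi x else
  match x with
  | origin => 0
  | limpt d g => L x (fun n => \sum_(ci <- d n) ci.1%:~R * extend (g ci.2))
  end.

Lemma extend_in x : D x -> extend x = phi x.
Proof. by case: x => [|d g] /asboolP /= ->. Qed.

Lemma extend_notin x : ~ D x -> x <> origin ->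
  extend x = L x (fun n => ev extend (term x n)).
Proof.
case: x => [|d g] // /asboolPn nD _ /=; rewrite (negbTE nD); congr L.
by apply/funext => n; rewrite ev_sum; apply: eq_bigr => ci _; rewrite evU.
Qed.

End Extension.

Section Admissible.
Variable R : realType.

(** The homomorphisms to the circle for which every good formal limit is the limit of its
    family along the ultrafilter attached to it. *)
Definition admissible (phi : gen -> R) : Prop := forall x, good x ->
  forall e, 0 < e -> ultra x [set n | dist_int (ev phi (term x n) - phi x) < e].

Lemma good_origin : ~ good origin.
Proof.
case=> [[h _]|[h _ _]]; first by have := h (0, 0)%N; rewrite /= /l1 dom0 big_nil.
by have := h (0, 0)%N; rewrite eqxx.
Qed.

(** Only the countably many generators below the support of [v] influence the value at [v];
    there [countable_approximation] applies, and [extend] takes care of the others. *)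
Lemma admissible_separation (v : {freeg gen}) : v != 0 ->
  exists2 phi, admissible phi & 4^-1 <= dist_int (ev phi v).
Proof.
move=> v0.
pose D : set gen := \bigcup_(x in [set` dom v]) ([set x] `|` below x).
have Dv k : k \in dom v -> D k by move=> kv; exists k => //; left.
have Dbelow x k : D x -> below x k -> D k.
  by move=> [y yv [->|yx]] xk; exists y => //; right => //; exact: below_trans xk.
have cD : countable D.
  apply: bigcup_countable.
    by apply: finite_set_countable; exact: finite_seq.
  move=> x _; rewrite (_ : _ `|` _ =
    \bigcup_(b in [set: bool]) if b then [set x] else below x).
    apply: bigcup_countable => // -[] _; last exact: countable_below.
    by apply: finite_set_countable; exact: finite_set1.
  by apply/seteqP; split => [y [?|?]|y [[] _ ?]]; [exists true|exists false|left|right].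
have [st stP] := trace_separation cD.
have /choice[C CP] : forall x, exists C, scattered x -> forall n, (l1 (term x n) <= C)%N.
  move=> x; have [[_ _ [C h]]|ns] := pselect (scattered x); first by exists C.
  by exists 0%N.
pose start x := maxn (st x) (maxn (8 * l1 v + 2) (C x)).
have [|||phi [phiv phiP]] := @countable_approximation R v D start _ _ _ v0.
- move=> x y N Dx Dy xN yN; rewrite !geq_max => /andP[sx _] /andP[sy _].
  exact: stP sx sy.
- by move=> x _; rewrite /start !leq_max leqnn orbT.
- by move=> x n _ /CP/(_ n) h; rewrite /start !leq_max h !orbT.
have /choice[L LP] : forall x, exists L : (nat * nat -> R) -> R, forall y e, 0 < e ->
    ultra x [set n | dist_int (y n - L y) < e].
  move=> x; have xU := ultraP x.
  have /choice[l lP] : forall y : nat * nat -> R, exists l, forall e, 0 < e ->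
      ultra x [set n | dist_int (y n - l) < e] by move=> y; exact: ultra_lim.
  by exists l => y e; exact: lP.
exists (extend D phi L); last first.
  rewrite (@eq_ev _ _ _ phi) // => k kv; apply: extend_in; exact: Dv.
move=> x gx e e0.
have [Dx|nDx] := pselect (D x).
  rewrite (_ : [set _ | _] = [set n | dist_int (ev phi (term x n) - phi x) < e]).
    by apply: large_ultra; exact: phiP.
  apply/seteqP; split => n /=; rewrite extend_in // (@eq_ev _ _ (extend D phi L) phi) //;
    by move=> k /dom_term xk; apply: extend_in; exact: Dbelow xk.
rewrite extend_notin //; first exact: LP.
by move=> xo; apply: good_origin; rewrite -xo.
Qed.

End Admissible.

(** * Sparse and scattered subsequences and their formal limits *)

Lemma greedy_subsequence (Q : nat -> Prop) (r : nat -> nat -> Prop) :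
  (forall s : seq nat, exists n, Q n /\ forall i, i \in s -> (i < n)%N /\ r i n) ->
  exists f : nat -> nat, (forall n, Q (f n)) /\
    forall i j, (i < j)%N -> (f i < f j)%N /\ r (f i) (f j).
Proof.
move=> /choice[pick pickP].
pose S := fix S n := if n is m.+1 then pick (S m) :: S m else [::].
have inS i j : (i < j)%N -> pick (S i) \in S j.
  elim: j => // j IH; rewrite ltnS leq_eqVlt => /predU1P[->|/IH h].
    by rewrite inE eqxx.
  by rewrite inE h orbT.
exists (fun n => pick (S n)); split=> [n|i j ij].
  by have [] := pickP (S n).
by have [_ h] := pickP (S j); apply: h; exact: inS.
Qed.

Lemma strictly_increasing_ge (f : nat -> nat) :
  (forall i j, (i < j)%N -> (f i < f j)%N) -> forall n, (n <= f n)%N.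
Proof. by move=> h; elim=> // n IH; apply: leq_ltn_trans IH _; exact: h. Qed.

Lemma bound_seq (s : seq nat) (f : nat -> nat) :
  exists m, forall i, i \in s -> (f i <= m)%N.
Proof.
elim: s => [|i s [m hm]]; first by exists 0%N.
exists (maxn (f i) m) => j; rewrite inE leq_max => /predU1P[->|/hm ->].
  by rewrite leqnn.
by rewrite orbT.
Qed.

Lemma unbounded_subsequence (K : choiceType) (a : nat -> {freeg K}) :
  (forall c, exists n, (c < l1 (a n))%N) ->
  exists f : nat -> nat, [/\ forall i j, (i < j)%N -> (f i < f j)%N,
    forall n, (1 < l1 (a (f n)))%N &
    forall i j, (i < j)%N -> (l1 (a (f i)) ^ 4 <= l1 (a (f j)))%N].
Proof.
move=> unb.
have [|f [f1 f2]] := @greedy_subsequence (fun n => (1 < l1 (a n))%N)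
  (fun i n => (l1 (a i) ^ 4 <= l1 (a n))%N).
  move=> s; have [m hm] := bound_seq s id.
  have [c hc] := bound_seq (s ++ iota 0 m.+1) (fun i => l1 (a i) ^ 4 + 1)%N.
  have le_pow b : (b <= b ^ 4)%N by case: b => // b; rewrite -{1}[b.+1]expn1 leq_pexp2l.
  have [n hn] := unb c; exists n.
  have mn : (m < n)%N.
    rewrite ltnNge; apply/negP => nm.
    have := hc n; rewrite mem_cat mem_iota /= ltnS nm orbT => /(_ isT).
    by have := le_pow (l1 (a n)); lia.
  split.
    have := hc 0%N; rewrite mem_cat mem_iota /= orbT => /(_ isT); lia.
  move=> i si; split; first exact: leq_ltn_trans (hm i si) mn.
  by have := hc i; rewrite mem_cat si => /(_ isT); lia.
by exists f; split => // i j /f2[].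
Qed.

Lemma pigeonhole (T : eqType) (h : nat -> T) (P : nat -> Prop) (s : seq T) :
  (forall m, exists n, [/\ (m <= n)%N, P n & h n \in s]) ->
  exists z, forall m, exists n, [/\ (m <= n)%N, P n & h n = z].
Proof.
elim: s => [|z s IH] hs; first by have [n []] := hs 0%N.
have [hz|/existsNP[m0 hz]] :=
  pselect (forall m, exists n, [/\ (m <= n)%N, P n & h n = z]).
  by exists z.
apply: IH => m; have [n [mn Pn]] := hs (maxn m m0).
move: mn; rewrite geq_max => /andP[mn m0n].
rewrite inE => /predU1P[e|ns]; last by exists n.
by case: hz; exists n.
Qed.

Lemma int_bounded_seq (c : nat) (z : int) : (`|z| <= c)%N ->
  z \in [seq Posz i | i <- iota 0 c.+1] ++ [seq - Posz i | i <- iota 0 c.+1].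
Proof.
rewrite mem_cat; case: z => i ic; apply/orP.
  by left; apply/mapP; exists i => //; rewrite mem_iota.
by right; apply/mapP; exists i.+1 => //; rewrite mem_iota.
Qed.

(** If some generator occurs in infinitely many members, it occurs with the same nonzero
    coefficient infinitely often; removing it lowers the norm, and induction applies.
    Otherwise each generator occurs in finitely many members, and disjoint supports are
    chosen greedily. *)
Lemma bounded_subsequence (K : choiceType) (c : nat) (a : nat -> {freeg K}) :
  (forall n, (l1 (a n) <= c)%N) ->
  exists r (f : nat -> nat), (forall i j, (i < j)%N -> (f i < f j)%N) /\
    ((forall n, a (f n) = r) \/
     [/\ forall n, a (f n) - r != 0,
         forall n, (l1 (a (f n) - r)%R <= c)%N &
         forall i j k, (i < j)%N ->
           k \in dom (a (f i) - r) -> k \notin dom (a (f j) - r)]).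
Proof.
elim: c a => [|c IH] a ac.
  have a0 n : a n = 0 by apply/eqP; rewrite -l1_eq0 -leqn0.
  by exists 0, id; split=> //; left.
have [[k hk]|nk] :=
  pselect (exists k, forall m, exists n, (m <= n)%N /\ coeff k (a n) != 0).
  have [|z hz] := @pigeonhole _ (fun n => coeff k (a n)) (fun n => coeff k (a n) != 0)
    ([seq Posz i | i <- iota 0 c.+2] ++ [seq - Posz i | i <- iota 0 c.+2]).
    move=> m; have [n [mn kn]] := hk m; exists n; split => //.
    by apply: int_bounded_seq; apply: leq_trans (coeff_le_l1 _ _) (ac n).
  have [|f [f1 f2]] := @greedy_subsequence
      (fun n => coeff k (a n) != 0 /\ coeff k (a n) = z) (fun _ _ => True).
    move=> s; have [m hm] := bound_seq s id.
    have [n [mn kn e]] := hz m.+1; exists n; split => // i si; split => //.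
    exact: leq_ltn_trans (hm i si) mn.
  have [n|r [g [g1 g2]]] := IH (fun n => a (f n) - << z *g k >>).
    have [kn <-] := f1 n; rewrite -ltnS; apply: leq_trans (ac (f n)).
    by apply: l1_remove; rewrite mem_dom.
  exists (r + << z *g k >>), (f \o g); split=> [i j ij|].
    by have [] := f2 _ _ (g1 i j ij).
  have e n : a (f (g n)) - (r + << z *g k >>) = a (f (g n)) - << z *g k >> - r.
    by rewrite opprD addrA addrAC.
  case: g2 => [h|[h1 h2 h3]]; [left|right].
    by move=> n; rewrite /= -(h n) subrK.
  split=> [n|n|i j k' ij]; rewrite /= ?e //; first exact: leq_trans (h2 n) _.
  exact: h3.
have {nk}/choice[m hm] : forall k, exists m, forall n, (m <= n)%N -> coeff k (a n) = 0.
  move=> k; apply: contrapT => h; apply: nk; exists k => m.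
  apply: contrapT => h'; apply: h; exists m => n mn.
  by apply/eqP; apply: contrapT => /negP ne; apply: h'; exists n.
have [inf|/existsNP[m0 fin]] :=
  pselect (forall m, exists n, (m <= n)%N /\ a n != 0); last first.
  have a0 n : (m0 <= n)%N -> a n = 0.
    by move=> mn; apply/eqP; apply: contrapT => /negP ne; apply: fin; exists n.
  exists 0, (fun n => m0 + n)%N; split=> [i j|]; first by rewrite ltn_add2l.
  by left => n; rewrite a0 ?leq_addr.
have [|f [f1 f2]] := @greedy_subsequence (fun n => a n != 0)
    (fun i n => forall k, k \in dom (a i) -> k \notin dom (a n)).
  move=> s; have [b hb] := bound_seq s id.
  have [b' hb'] : exists b, forall i k, i \in s -> k \in dom (a i) -> (m k <= b)%N.
    elim: s {hb} => [|i s [b' hb']]; first by exists 0%N.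
    exists (maxn b' (\sum_(k <- dom (a i)) m k)%N) => j k.
    rewrite inE leq_max => /predU1P[->|js] kj; last by rewrite (hb' j).
    by rewrite (bigD1_seq k) ?uniq_dom //= leq_addr orbT.
  have [n [mn n0]] := inf (maxn b.+1 b'); exists n; split => // i si.
  move: mn; rewrite geq_max => /andP[bn b'n].
  split; first exact: leq_ltn_trans (hb i si) bn.
  move=> k ki; rewrite mem_dom negbK; apply/eqP; apply: hm.
  exact: leq_trans (hb' i k si ki) b'n.
exists 0, f; split=> [i j /f2[]//|]; right.
split=> [n|n|i j k ij]; rewrite ?subr0 //.
by have [_ h] := f2 i j ij; exact: h.
Qed.

(** The generators occurring in countably many elements can be enumerated; the enumeration
    used here is by the position in the support of a member. *)
Lemma term_surjective (b : nat * nat -> {freeg gen}) :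
  exists x, forall n, term x n = b n.
Proof.
pose g j : gen := if unpickle j is Some (n, l) then nth origin (dom (b n)) l else origin.
pose d n := [seq (coeff (nth origin (dom (b n)) l) (b n), pickle (n, l))
            | l <- iota 0 (size (dom (b n)))].
exists (limpt d g) => n /=; rewrite big_map -[RHS]freeg_sumE (big_nth origin).
by rewrite /index_iota subn0; apply: eq_bigr => l _; rewrite /g pickleK.
Qed.

(** * The cone of elements with positive leading coefficients *)

Lemma exists_maximal (s : seq gen) : s != [::] ->
  exists2 k, k \in s & forall j, j \in s -> ~ below j k.
Proof.
elim: s => [//|x [|y s] IH] _.
  exists x; rewrite ?inE // => j; rewrite inE => /eqP ->; exact: below_irr.
have [//|k ks kmax] := IH.
have [xk|nxk] := pselect (below x k).
  exists x; first by rewrite inE eqxx.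
  move=> j; rewrite inE => /predU1P[->|js jx]; first exact: below_irr.
  exact: (kmax j js (below_trans jx xk)).
exists k; first by rewrite inE ks orbT.
by move=> j; rewrite inE => /predU1P[->//|]; exact: kmax.
Qed.

Lemma maximal_above (s : seq gen) (j k : gen) : j \in s -> below j k ->
  exists k', [/\ k' \in s, below k' k & forall i, i \in s -> ~ below i k'].
Proof.
move=> js jk; pose t := [seq i <- s | `[< below i k >]].
have [|k' + k'max] := @exists_maximal t.
  have : j \in t by rewrite mem_filter js andbT; apply/asboolP.
  by case: t.
rewrite mem_filter => /andP[/asboolP k'k k's]; exists k'; split => // i si ik'.
apply: (k'max i) => //; rewrite mem_filter si andbT; apply/asboolP.
exact: below_trans ik' k'k.
Qed.

(** The elements whose leading terms, in the partial order [below], have positive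
    coefficients. *)
Definition cone : set {freeg gen} := [set v | forall k, k \in dom v ->
  (forall j, j \in dom v -> ~ below j k) -> 0 < coeff k v].

Lemma cone0 : cone 0.
Proof. by move=> k; rewrite dom0. Qed.

(** A generator which is maximal in the union of the two supports cannot cancel, as neither
    of its coefficients is negative. *)
Lemma coneD u v : cone u -> cone v -> cone (u + v).
Proof.
move=> cu cv.
have ge0 w k : cone w -> (forall j, j \in dom w -> ~ below j k) -> 0 <= coeff k w.
  move=> cw kmax; have [kw|kw] := boolP (k \in dom w); last by rewrite coeff_outdom.
  exact/ltW/cw.
have pos k : k \in dom u ++ dom v -> (forall j, j \in dom u ++ dom v -> ~ below j k) ->
    0 < coeff k (u + v).
  move=> kuv kmax.
  have ku j : j \in dom u -> ~ below j k by move=> ju; apply: kmax; rewrite mem_cat ju.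
  have kv j : j \in dom v -> ~ below j k.
    by move=> jv; apply: kmax; rewrite mem_cat jv orbT.
  rewrite coeffD; move: kuv; rewrite mem_cat => /orP[kD|kD].
    by apply: ltr_wpDr; [exact: ge0|exact: cu].
  by apply: ltr_wpDl; [exact: ge0|exact: cv].
move=> k kD kmax; apply: (pos); first exact: domD_subset.
move=> j js jk; have [k' [k's k'k k'max]] := maximal_above js jk.
by apply: (kmax k') => //; rewrite mem_dom gt_eqF // pos.
Qed.

Lemma cone_pointed v : cone v -> cone (- v) -> v = 0.
Proof.
move=> cv cNv; apply/eqP; rewrite -dom_eq0; apply: contrapT => /negP ne.
have [k kv kmax] := exists_maximal ne.
have := cv k kv kmax; have := cNv k; rewrite domN kv => /(_ isT).
rewrite coeffN oppr_gt0 => h /lt_trans /(_ (h _)); rewrite ltxx => h'; apply: notF.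
by apply: h' => j; rewrite domN; exact: kmax.
Qed.

(** The leading term of [<< x >> - term x n] is x, since all generators of [term x n] lie
    below x. *)
Lemma cone_term x n : cone (<< x >> - term x n).
Proof.
move=> k kD kmax; rewrite coeffB coeffU1.
have xD : x \in dom (<< x >> - term x n).
  by rewrite mem_dom coeffB coeffU1 eqxx coeff_outdom ?term_notin // subr0.
have [<-|ne] := eqVneq x k; first by rewrite coeff_outdom ?term_notin // subr0.
have : k \in dom (term x n).
  by move: kD; rewrite !mem_dom coeffB coeffU1 (negbTE ne) sub0r oppr_eq0.
by move=> /dom_term /(kmax x xD).
Qed.

(** * Cluster points *)

Section Topology.
Variable R : realType.

Definition small (k : nat) (f : nat -> gen -> R) (e : R) (v : {freeg gen}) : Prop :=
  forall i, (i < k)%N -> dist_int (ev (f i) v) < e.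

Lemma term_clusters x k (f : nat -> gen -> R) e m : good x ->
  (forall i, (i < k)%N -> admissible (f i)) -> 0 < e ->
  exists n, (m <= pickle n)%N /\ small k f e (<< x >> - term x n).
Proof.
move=> gx fadm e0.
have xU := ultraP x.
have h1 : ultra x [set n | forall i, i \in iota 0 k ->
    dist_int (ev (f i) (term x n) - f i x) < e].
  apply: (filter_all_seq
    (A := fun i => [set n | dist_int (ev (f i) (term x n) - f i x) < e])).
  by move=> i; rewrite mem_iota /= add0n => ik; exact: fadm.
have h2 : ultra x [set n | (m <= pickle n)%N].
  apply: large_ultra; pose code_pair j : nat * nat := odflt (0, 0)%N (unpickle j).
  pose M := (\sum_(j < m) (code_pair j).1.+1)%N.
  apply: (@large_cofinite x _ M) => N i MN /=; rewrite leqNgt; apply/negP => lt.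
  suff : (N < M)%N by rewrite ltnNge MN.
  by rewrite /M (bigD1 (Ordinal lt)) //= /code_pair pickleK /= addSn ltnS leq_addr.
have [n [/= hn mn]] := filter_ex (filterI h1 h2).
exists n; split => // i ik; rewrite -dist_intN -evN opprB evB evU mul1r.
by apply: hn; rewrite mem_iota.
Qed.

(** Pass to a subsequence which after subtracting a constant r is null, sparse or scattered.
    In the last two cases let x be the formal limit of the opposite family; the cluster
    point is r - x. The opposite is taken because of the cone: the differences with the
    cluster point are then of the form considered in [cone_term]. *)
Lemma accumulation (a : nat -> {freeg gen}) : exists x,
  forall k (f : nat -> gen -> R) e m,
  (forall i, (i < k)%N -> admissible (f i)) -> 0 < e ->
  exists n, [/\ (m <= n)%N, cone (a n - x) & small k f e (a n - x)].
Proof.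
have main r (f : nat -> nat) x : (forall i j, (i < j)%N -> (f i < f j)%N) -> good x ->
    (forall n, term x n = r - a (f (pickle n))) -> exists x,
    forall k (f : nat -> gen -> R) e m,
    (forall i, (i < k)%N -> admissible (f i)) -> 0 < e ->
    exists n, [/\ (m <= n)%N, cone (a n - x) & small k f e (a n - x)].
  move=> finc gx xt; exists (r - << x >>) => k g e m gadm e0.
  have [n [mn sm]] := term_clusters m gx gadm e0.
  have E : a (f (pickle n)) - (r - << x >>) = << x >> - term x n.
    by rewrite xt opprB opprB addrC addrA addrAC.
  exists (f (pickle n)); rewrite E; split => //; last exact: cone_term.
  exact: leq_trans mn (strictly_increasing_ge finc _).
have wlog_lt (P : nat -> nat -> Prop) : (forall i j, P i j -> P j i) ->
    (forall i j, (i < j)%N -> P i j) ->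
    forall n n' : nat * nat, n <> n' -> P (pickle n) (pickle n').
  move=> Psym Plt n n' nn'.
  have [lt|lt|e] := ltngtP (pickle n) (pickle n'); [exact: Plt|exact/Psym/Plt|].
  by case: nn'; apply: (pcan_inj pickleK).
have [[c hc]|unb] := pselect (exists c, forall n, (l1 (a n) <= c)%N).
  have [r [f [finc [h|[h1 h2 h3]]]]] := bounded_subsequence hc.
    exists r => k g e m gadm e0; exists (f m).
    rewrite h subrr; split; [exact: strictly_increasing_ge|exact: cone0|].
    by move=> i ik; rewrite ev0 (dist_int_int R 0).
  have [x xt] := term_surjective (fun n => r - a (f (pickle n))).
  apply: (main r f x) => //; right; split=> [n|n n' k|].
  - by rewrite xt -opprB oppr_eq0.
  - rewrite !xt -(opprB (a _) r) -(opprB (a _) r) !domN.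
    apply: (wlog_lt (fun i j => k \in dom (a (f i) - r) -> k \notin dom (a (f j) - r))).
      by move=> i j hij kj; apply/negP => ki; have := hij ki; rewrite kj.
    by move=> i j ij; exact: h3.
  - by exists c => n; rewrite xt -opprB l1N.
have [|f [finc f1 f2]] := @unbounded_subsequence _ a.
  move=> c; apply: contrapT => h; apply: unb; exists c => n.
  by rewrite leqNgt; apply/negP => lt; apply: h; exists n.
have [x xt] := term_surjective (fun n => 0 - a (f (pickle n))).
apply: (main 0 f x) => //; left; split=> [n|n n'].
  by rewrite xt sub0r l1N.
rewrite !xt !sub0r !l1N.
apply: (wlog_lt (fun i j => (l1 (a (f i)) ^ 4 <= l1 (a (f j)))%N \/
                            (l1 (a (f j)) ^ 4 <= l1 (a (f i)))%N)).
  by move=> i j [] ?; [right|left].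
by move=> i j ij; left; exact: f2.
Qed.

End Topology.

(** * The paratopological group *)

Definition cgroup (R : realType) : Type := {freeg gen}.

Section CGroup.
Variable R : realType.
Local Notation G := (cgroup R).

HB.instance Definition _ := Choice.copy G {freeg gen}.

(** Finitely many functionals are given as the first k values of a sequence. *)
Definition cgroup_nbhs (x : G) : set_system G := [set A | exists k (f : nat -> gen -> R) e,
  [/\ forall i, (i < k)%N -> admissible (f i), 0 < e &
      forall y : {freeg gen}, cone (y - (x : {freeg gen})) ->
        small k f e (y - (x : {freeg gen})) -> A y]].

HB.instance Definition _ := hasNbhs.Build G cgroup_nbhs.

Lemma cgroup_nbhs_filter (x : G) : ProperFilter (nbhs x).
Proof.
split.
  move=> [k [f [e [_ e0 h]]]]; apply: (h x); rewrite subrr; first exact: cone0.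
  by move=> i _; rewrite ev0 (dist_int_int R 0).
split.
- by exists 0%N, (fun _ _ => 0), 1.
- move=> A B [k [f [e [fa e0 hA]]]] [l [g [d [ga d0 hB]]]].
  exists (k + l)%N, (fun i => if (i < k)%N then f i else g (i - k)%N), (Num.min e d).
  split=> [i ikl||y cy sy].
  - by case: ltnP => ik; [exact: fa|apply: ga; rewrite ltn_subLR].
  - by rewrite lt_min e0.
  - split; [apply: hA|apply: hB] => // i il.
      have := sy i (ltn_addr _ il); rewrite il => h.
      by apply: lt_le_trans h _; rewrite ge_min lexx.
    have /sy : (k + i < k + l)%N by rewrite ltn_add2l.
    rewrite ltnNge leq_addr /= addKn => h.
    by apply: lt_le_trans h _; rewrite ge_min lexx orbT.
- move=> A B AB [k [f [e [fa e0 h]]]]; exists k, f, e; split => // y cy sy.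
  exact/AB/h.
Qed.

Lemma cgroup_nbhs_singleton (x : G) (A : set G) : nbhs x A -> A x.
Proof.
move=> [k [f [e [_ e0 h]]]]; apply: (h x); rewrite subrr; first exact: cone0.
by move=> i _; rewrite ev0 (dist_int_int R 0).
Qed.

(** The reason why the basic neighbourhoods are open. *)
Lemma small_room k (f : nat -> gen -> R) e (v : {freeg gen}) : small k f e v -> 0 < e ->
  exists2 d, 0 < d & forall w, small k f d w -> small k f e (v + w).
Proof.
move=> sv e0; have [d d0 hd] : exists2 d, 0 < d &
    forall i, (i < k)%N -> dist_int (ev (f i) v) + d <= e.
  elim: k sv => [|k IH] sv; first by exists 1.
  have [|d d0 hd] := IH; first by move=> i ik; apply: sv; exact: ltnW.
  exists (Num.min d (e - dist_int (ev (f k) v))).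
    by rewrite lt_min d0 subr_gt0 sv.
  move=> i; rewrite ltnS leq_eqVlt => /predU1P[->|ik].
    by rewrite -lerBrDl ge_min lexx orbT.
  by apply: le_trans (hd i ik); rewrite lerD2l ge_min lexx.
exists d => // w sw i ik; rewrite evD; apply: le_lt_trans (dist_intD _ _) _.
by apply: lt_le_trans (hd i ik); rewrite ltrD2l; exact: sw.
Qed.

Lemma cgroup_nbhs_nbhs (x : G) (A : set G) : nbhs x A -> nbhs x (nbhs^~ A).
Proof.
move=> [k [f [e [fa e0 h]]]]; exists k, f, e; split => // y cy sy.
have [d d0 hd] := small_room sy e0.
exists k, f, d; split => // z cz sz.
have E : z - (x : {freeg gen}) = (y - (x : {freeg gen})) + (z - y).
  by rewrite [RHS]addrC addrA subrK.
by apply: h; rewrite E; [exact: coneD|exact: hd].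
Qed.

HB.instance Definition _ := Nbhs_isNbhsTopological.Build G
  cgroup_nbhs_filter cgroup_nbhs_singleton cgroup_nbhs_nbhs.

HB.instance Definition _ := isGroup.Build G
  (@addrA {freeg gen}) (@add0r {freeg gen}) (@addr0 {freeg gen})
  (@addNr {freeg gen}) (@addrN {freeg gen}).

Lemma cgroup_mulg_continuous : continuous (fun x : G * G => (x.1 * x.2)%g).
Proof.
move=> [x y] A /= [k [f [e [fa e0 h]]]].
have e20 : 0 < e / 2 by rewrite divr_gt0.
exists ([set z : G | cone ((z : {freeg gen}) - (x : {freeg gen})) /\
                     small k f (e / 2) ((z : {freeg gen}) - (x : {freeg gen}))],
        [set z : G | cone ((z : {freeg gen}) - (y : {freeg gen})) /\
                     small k f (e / 2) ((z : {freeg gen}) - (y : {freeg gen}))]).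
  by split; exists k, f, (e / 2).
move=> [z t] /= [[cz sz] [ct st]].
have E : ((z : {freeg gen}) + (t : {freeg gen})) - ((x : {freeg gen}) + (y : {freeg gen})) =
   ((z : {freeg gen}) - (x : {freeg gen})) + ((t : {freeg gen}) - (y : {freeg gen})).
  by rewrite opprD addrACA.
apply: (h ((z : {freeg gen}) + (t : {freeg gen}))); rewrite E; first exact: coneD.
move=> i ik; rewrite evD [e]splitr; apply: le_lt_trans (dist_intD _ _) _.
by apply: ltrD; [exact: sz|exact: st].
Qed.

HB.instance Definition _ := PreTopologicalGroup_isParatopologicalGroup.Build G
  cgroup_mulg_continuous.

Lemma cgroup_functionally_hausdorff : functionally_hausdorff R G.
Proof.
move=> x y xy.
have [|phi phia sep] := @admissible_separation R ((x : {freeg gen}) - (y : {freeg gen})).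
  by rewrite subr_eq0; apply/eqP.
exists (fun z : G => dist_int (ev phi ((z : {freeg gen}) - (y : {freeg gen})))); last first.
  rewrite subrr ev0 (dist_int_int R 0) => h.
  by move: sep; rewrite h leNgt invr_gt0 ltr0n.
move=> z; have zF : Filter (nbhs (z : G)) := nbhs_filter (z : G).
apply: (proj2 (@cvgrPdist_lt _ _ _ _ zF _ _)) => e e0.
exists 1%N, (fun _ => phi), e; split => // t _ /(_ 0%N isT) st.
apply: le_lt_trans (dist_int_dist _ _) _; rewrite -dist_intN opprB -evB.
by rewrite opprB addrA subrK.
Qed.

(** If no finite subfamily covers, choose a point outside the first n members of the cover,
    for each n; a cluster point of these points lies in some member, a contradiction. *)
Lemma cgroup_countably_compact : countably_compact G.
Proof.
move=> C /countable_injP[c cinj] Copen Ccover; apply: contrapT => nfin.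
pose D n := C `&` [set U | (c U <= n)%N].
have /choice[a aP] : forall n, exists x : {freeg gen}, ~ (\bigcup_(U in D n) U) x.
  move=> n; apply/existsNP => h; apply: nfin; exists (D n); split.
  - have : finite_set (c @` D n).
      by apply: sub_finite_set (finite_II n.+1) => _ [U [_ Un] <-].
    rewrite (eq_finite_set (inj_card_eq _)) // => U V /set_mem[CU _] /set_mem[CV _].
    by apply: cinj; rewrite inE.
  - by move=> U [].
  - by apply/seteqP; split.
have [x xP] := accumulation R a.
have [U CU Ux] : (\bigcup_(U in C) U) (x : G) by rewrite Ccover.
have : nbhs (x : G) U by apply: open_nbhs_nbhs; split => //; exact: Copen.
move=> [k [f [e [fa e0 h]]]].
have [n [cn cy sy]] := xP k f e (c U) fa e0.
by apply: (aP n); exists U => //; exact: h.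
Qed.

(** The cone is a neighbourhood of 0. If inversion were continuous, [cone_pointed] would
    make 0 isolated, whereas the multiples of a generator have a cluster point. *)
Lemma cgroup_not_topological : ~ is_topological_group G.
Proof.
move=> cinv.
have n1 : nbhs ((1%g : G)^-1)%g (cone : set G).
  exists 0%N, (fun _ _ => 0), 1; split => // y cy _.
  by move: cy; change (cone (y - - 0) -> cone y); rewrite oppr0 subr0.
have [k [f [e [fa e0 h]]]] := cinv (1%g : G) _ n1.
pose a n : {freeg gen} := << n%:Z *g origin >>.
have [x xP] := accumulation R a.
have ax n : cone (a n - x) -> small k f e (a n - x) -> a n = x.
  move=> cn sn; apply/eqP; rewrite -subr_eq0; apply/eqP; apply: cone_pointed => //.
  by apply: (h (a n - x)); change (1%g : G) with (0 : {freeg gen}); rewrite subr0.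
have [n [_ cn sn]] := xP k f e 0%N fa e0.
have [m [nm cm sm]] := xP k f e n.+1 fa e0.
have : a n = a m by rewrite ax // ax.
move=> /(congr1 (coeff origin)); rewrite !coeffU eqxx !mulr1 => -[E].
by move: nm; rewrite E ltnn.
Qed.

Lemma cgroup_free_abelian : is_free_abelian G.
Proof. by exists gen, (fun x => x : G); split => //; exists id. Qed.

End CGroup.

Theorem corollary10p3 (R : realType) :
  exists G : paratopologicalGroupType,
    [/\ functionally_hausdorff R G, countably_compact G,
        ~ is_topological_group G & is_free_abelian G].
Proof.
exists (cgroup R); split.
- exact: cgroup_functionally_hausdorff.
- exact: cgroup_countably_compact.
- exact: cgroup_not_topological.
- exact: cgroup_free_abelian.
Qed.
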